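(* Let $k\ge2$ be an integer and let $P'_{8\cdot3^k}=\langle x,y,z\mid x^2=(xy)^2=y^2,\ zxz^{-1}=y,\ zyz^{-1}=xy,\ z^{3^k}=1\rangle$. The conjugacy classes of $P'_{8\cdot3^k}$ are exactly the following $7\cdot3^{k-1}$ sets, where $l=0,\dots,3^{k-1}-1$: - $\{z^{3l}\}$; - $\{x^2z^{3l}\}$; - $\{z^{3l+1},\ x^3z^{3l+1},\ x^2yz^{3l+1},\ x^3yz^{3l+1}\}$; - $\{z^{3l+2},\ xz^{3l+2},\ yz^{3l+2},\ xyz^{3l+2}\}$; - $\{xz^{3l+1},\ x^2z^{3l+1},\ yz^{3l+1},\ xyz^{3l+1}\}$; - $\{x^2z^{3l+2},\ x^3z^{3l+2},\ x^2yz^{3l+2},\ x^3yz^{3l+2}\}$; - $\{xz^{3l},\ yz^{3l},\ x^3z^{3l},\ xyz^{3l},\ x^2yz^{3l},\ x^3yz^{3l}\}$. They have $1,1,4,4,4,4,6$ elements respectively.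
   Context: The group $P'_{8\cdot3^k}$ has order $8\cdot3^k$. *)

(* Defs.v *)
From mathcomp Require Import all_boot all_fingroup.

Set Implicit Arguments.
Unset Strict Implicit.
Unset Printing Implicit Defensive.

Local Open Scope group_scope.

(* G is the group <x, y, z | x^2 = (xy)^2 = y^2, zxz^-1 = y, zyz^-1 = xy,
   z^(3^k) = 1>, with x, y, z the named generators.  Since the generators are
   existentially quantified inside [\isog Grp], the first two clauses single out
   x, y, z; as G is finite, any generating triple satisfying the relations
   corresponds to the generators of the presentation under an isomorphism.
   Also, [\isog Grp] identifies G with the largest finite quotient of the
   abstract group; that group is finite (of order 8 * 3^k), so G is isomorphic
   to the abstract group itself. *)
Definition is_P'8_3 (k : nat) (gT : finGroupType) (G : {group gT})
    (x y z : gT) : Prop :=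
  [/\ <<[set x; y; z]>> = G,
      [/\ x ^+ 2 = (x * y) ^+ 2, (x * y) ^+ 2 = y ^+ 2,
          z * x * z^-1 = y, z * y * z^-1 = x * y & z ^+ (3 ^ k)%N = 1] &
      G \isog Grp (x : y : z :
        x ^+ 2 = (x * y) ^+ 2, (x * y) ^+ 2 = y ^+ 2,
        z * x * z^-1 = y, z * y * z^-1 = x * y, z ^+ (3 ^ k)%N)].

(* The i-th family of sets in the list (i = 0, ..., 6), at parameter l. *)
Definition P'8_3_class (gT : finGroupType) (x y z : gT) (i l : nat) :
    {set gT} :=
  let z0 := z ^+ (3 * l)%N in
  let z1 := z ^+ (3 * l + 1)%N in
  let z2 := z ^+ (3 * l + 2)%N in
  nth set0
    [:: [set z0];
        [set x ^+ 2 * z0];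
        [set z1; x ^+ 3 * z1; x ^+ 2 * y * z1; x ^+ 3 * y * z1];
        [set z2; x * z2; y * z2; x * y * z2];
        [set x * z1; x ^+ 2 * z1; y * z1; x * y * z1];
        [set x ^+ 2 * z2; x ^+ 3 * z2; x ^+ 2 * y * z2; x ^+ 3 * y * z2];
        [set x * z0; y * z0; x ^+ 3 * z0; x * y * z0; x ^+ 2 * y * z0;
             x ^+ 3 * y * z0]] i.

Definition P'8_3_class_size (i : nat) : nat := nth 0%N [:: 1; 1; 4; 4; 4; 4; 6]%N i.

(* Main.v *)
Require Import Defs.
From mathcomp Require Import all_boot all_fingroup.

Set Implicit Arguments.
Unset Strict Implicit.
Unset Printing Implicit Defensive.

Local Open Scope group_scope.

(* Every element of G is q z^c with q = x^(2s + a) y^b, where z acts on the q's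
   as an automorphism of order 3 of Q_8; hence #|G| <= 8 * 3^k.  Conversely, the
   permutations of Q_8 x Z/3^k given by right multiplication in the semidirect
   product satisfy the relations and generate a transitive group, which is a
   homomorphic image of G; so #|G| >= 8 * 3^k and the normal form is unique.
   Conjugation in normal form only depends on c mod 3, which leaves a finite
   computation in Q_8. *)

(** * Arithmetic in the quaternion group and its automorphism of order 3 *)

(* The quaternion group: (s, a, b) stands for x^(2s + a) y^b. *)
Definition q8 : finType := (bool * bool * bool)%type.

(* y^b x^a' = x^(2 (a' && b)) x^a' y^b, and x^2 = y^2 is central. *)
Definition q8_mul (p q : q8) : q8 :=
  let: (s, a, b) := p in let: (s', a', b') := q in
  (s (+) s' (+) (b && a') (+) (a && a') (+) (b && b'), a (+) a', b (+) b').

Definition q8_inv (p : q8) : q8 :=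
  let: (s, a, b) := p in (s (+) (a || b), a, b).

(* The action of z: x |-> y |-> xy |-> x. *)
Definition q8_rot (p : q8) : q8 := let: (s, a, b) := p in (s, b, a (+) b).

Definition q8x : q8 := (false, true, false).
Definition q8y : q8 := (false, false, true).
Definition q8_1 : q8 := (false, false, false).

(** An explicit list, so that [vm_compute] can evaluate quantification over Q_8. *)
Definition q8_enum : seq q8 :=
  let bs := [:: false; true] in
  [seq (sa, b) | sa <- [seq (s, a) | s <- bs, a <- bs], b <- bs].

Lemma mem_q8_enum p : p \in q8_enum.
Proof. by case: p => [[[] []] []]. Qed.

Lemma q8_rotM p q : q8_rot (q8_mul p q) = q8_mul (q8_rot p) (q8_rot q).
Proof. by case: p q => [[[] []] []] [[[] []] []]. Qed.

Lemma q8_mulA : associative q8_mul.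
Proof. by move=> [[[] []] []] [[[] []] []] [[[] []] []]. Qed.

Lemma q8_rot3 p : q8_rot (q8_rot (q8_rot p)) = p.
Proof. by case: p => [[[] []] []]. Qed.

Lemma iter_q8_rot_mod c : iter c q8_rot =1 iter (c %% 3) q8_rot.
Proof.
move=> p; rewrite {1}(divn_eq c 3) iterD iterM.
by elim: (c %/ 3) => //= m ->; rewrite q8_rot3.
Qed.

Lemma iter_q8_rotM c p q :
  iter c q8_rot (q8_mul p q) = q8_mul (iter c q8_rot p) (iter c q8_rot q).
Proof. by elim: c => //= c ->; rewrite q8_rotM. Qed.

(** * Consequences of the relations: the product in normal form *)

Section Relations.

Variables (gT : finGroupType) (x y z : gT).
Hypothesis x2 : x ^+ 2 = (x * y) ^+ 2.
Hypothesis y2 : (x * y) ^+ 2 = y ^+ 2.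
Hypothesis zx : z * x * z^-1 = y.
Hypothesis zy : z * y * z^-1 = x * y.

Definition q8_val (p : q8) : gT :=
  let: (s, a, b) := p in x ^+ (s.*2 + a) * y ^+ b.

(** Cancelling [y] on the right in [(x * y) ^+ 2 = y ^+ 2] leaves [x * y * x = y]. *)
Lemma relation_yx : y * x = x^-1 * y.
Proof.
apply: (mulgI x); rewrite mulKVg; apply: (mulIg y).
by rewrite -[RHS]/(y ^+ 2) -y2 expgS expg1 !mulgA.
Qed.

(** Moving [y] past [x ^+ 2] inverts it by [relation_yx], yet fixes it because [x ^+ 2 = y ^+ 2];
    hence [x ^+ 2 = x ^- 2]. *)
Lemma relation_x4 : x ^+ 4 = 1.
Proof.
have e1 : y * x ^+ 2 = x ^- 2 * y.
  by rewrite expgS expg1 mulgA relation_yx -mulgA relation_yx invMg !mulgA.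
have e2 : y * x ^+ 2 = x ^+ 2 * y by rewrite x2 y2 -expgS -expgSr.
have e3 : x ^+ 2 = x ^- 2 by apply: (mulIg y); rewrite -e1 -e2.
by rewrite (expgD x 2 2) {1}e3 mulVg.
Qed.

Lemma relation_xmod m n : m = n %[mod 4] -> x ^+ m = x ^+ n.
Proof.
by move=> e; rewrite -(expg_mod m relation_x4) e expg_mod ?relation_x4.
Qed.

Lemma q8_val_mulx p : q8_val p * x = q8_val (q8_mul p q8x).
Proof.
case: p => [[s a] []] /=; last first.
  rewrite !mulg1 -expgSr; apply: relation_xmod.
  by case: s a => [] [].
(* Here [x^-1 = x ^+ 3], so moving [x] left past [y] adds 3 to the exponent. *)
have -> : x ^+ (s.*2 + a) * y * x = x ^+ (s.*2 + a + 3) * y.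
  rewrite -mulgA relation_yx mulgA; congr (_ * _).
  rewrite (expgD _ _ 3); congr (_ * _); apply: (mulgI x).
  by rewrite mulgV -expgS relation_x4.
by congr (_ * _); apply: relation_xmod; case: s a => [] [].
Qed.

Lemma q8_val_muly p : q8_val p * y = q8_val (q8_mul p q8y).
Proof.
case: p => [[s a] []] /=; last first.
  by rewrite mulg1; congr (_ * _); apply: relation_xmod; case: s a => [] [].
rewrite -mulgA -[y * y]/(y ^+ 2) -y2 -x2 -expgD mulg1.
by apply: relation_xmod; case: s a => [] [].
Qed.

(** The right factor [x^m y^b] is appended one generator at a time; what remains is an identity in
    [q8], checked on all cases. *)
Lemma q8_valM p q : q8_val (q8_mul p q) = q8_val p * q8_val q.
Proof.
have vX m : q8_val p * x ^+ m = q8_val (iter m (q8_mul^~ q8x) p).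
  by elim: m => [|m IH]; rewrite ?mulg1 // expgSr mulgA IH q8_val_mulx.
case: q => [[s a] b]; rewrite {3}/q8_val mulgA vX.
have -> : forall r, q8_val r * y ^+ b = q8_val (if b then q8_mul r q8y else r).
  by move=> r; case: (b); rewrite ?mulg1 // expg1 q8_val_muly.
by congr q8_val; case: p s a b {vX} => [[[] []] []] [] [] [].
Qed.

Lemma q8_val1 : q8_val q8_1 = 1. Proof. by rewrite /= !mulg1. Qed.

Lemma q8_valx : q8_val q8x = x. Proof. by rewrite /= mulg1. Qed.

Lemma q8_valy : q8_val q8y = y. Proof. by rewrite /= mul1g. Qed.

Lemma q8_val_rot p : z * q8_val p = q8_val (q8_rot p) * z.
Proof.
have ex m : z * x ^+ m = y ^+ m * z.
  elim: m => [|m IH]; first by rewrite mulg1 mul1g.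
  by rewrite !expgSr mulgA IH -!mulgA -zx mulgKV.
case: p => [[s a] b] /=; rewrite mulgA ex -mulgA.
have -> : z * y ^+ b = (x * y) ^+ b * z.
  by case: b; rewrite ?mulg1 ?mul1g // !expg1 -zy mulgKV.
rewrite mulgA; congr (_ * _).
(* Both sides are now words in [x] and [y], so the equality can be evaluated in [q8]. *)
rewrite -q8_valy -q8_valx -q8_valM.
have e r m : q8_val r ^+ m = q8_val (iter m (q8_mul^~ r) q8_1).
  by elim: m => [|m IH]; rewrite ?q8_val1 // expgSr IH -q8_valM.
by rewrite !e -!q8_valM; case: s a b => [] [] [].
Qed.

Lemma q8_val_iter_rot c p :
  z ^+ c * q8_val p = q8_val (iter c q8_rot p) * z ^+ c.
Proof.
elim: c p => [|c IH] p; first by rewrite mulg1 mul1g.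
by rewrite expgS -mulgA IH mulgA q8_val_rot mulgA.
Qed.

Lemma semidirect_mul p c q d :
  (q8_val p * z ^+ c) * (q8_val q * z ^+ d)
    = q8_val (q8_mul p (iter c q8_rot q)) * z ^+ (c + d).
Proof.
by rewrite mulgA -[_ * z ^+ c * _]mulgA q8_val_iter_rot q8_valM expgD !mulgA.
Qed.

End Relations.

(** * The semidirect product as a permutation group *)

Lemma q8_mulI r : injective (q8_mul^~ r).
Proof. by move=> [[[] []] []] [[[] []] []]; case: r => [[[] []] []]. Qed.

Section Model.

Variable N : nat.

(** The pair [(p, c)] stands for [p z^c], and the map is right multiplication by [q]: moving [q]
    left past [z^c] applies the rotation [c] times. *)
Fact q8_translation_inj q :
  injective (fun t : q8 * 'I_N => (q8_mul t.1 (iter t.2 q8_rot q), t.2)).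
Proof.
move=> [p c] [p' c'] /= [e ec]; move: e.
by rewrite ec => /(@q8_mulI _ _ _) ->.
Qed.

Definition q8_translation q := perm (@q8_translation_inj q).

Fact shift_inj : injective (fun t : q8 * 'I_N => (t.1, ordS t.2)).
Proof.
move=> [p c] [p' c'] [-> e].
by congr (_, _); apply: ordS_inj; apply: val_inj.
Qed.

Definition shift := perm shift_inj.

Lemma q8_translationE q p c :
  q8_translation q (p, c) = (q8_mul p (iter c q8_rot q), c).
Proof. by rewrite permE. Qed.

Lemma shiftE p c : shift (p, c) = (p, ordS c).
Proof. by rewrite permE. Qed.

(** Products of permutations apply the left factor first, so right multiplications compose in the
    order of [q8_mul]. *)
Lemma q8_translationM p q :
  q8_translation p * q8_translation q = q8_translation (q8_mul p q).
Proof.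
by apply/permP=> -[r c]; rewrite permM !q8_translationE iter_q8_rotM q8_mulA.
Qed.

Lemma q8_translationX q n :
  q8_translation q ^+ n = q8_translation (iter n (q8_mul^~ q) q8_1).
Proof.
elim: n => [|n IH]; last by rewrite expgSr IH q8_translationM.
apply/permP=> -[p c]; rewrite q8_translationE perm1 /= iter_q8_rot_mod.
have := ltn_pmod c (isT : 0 < 3).
by case: p (c %% 3)%N => [[[] []] []] [|[|[|]]].
Qed.

Lemma shiftX n p (c : 'I_N) : ((shift ^+ n) (p, c)).1 = p /\
  ((shift ^+ n) (p, c)).2 = (c + n) %% N :> nat.
Proof.
elim: n => [|n [IH1 IH2]]; first by rewrite perm1 addn0 modn_small.
rewrite expgSr permM; case: (_ (p, c)) IH1 IH2 => p' c' /= -> e.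
by rewrite shiftE /= e -addn1 modnDml addn1 addnS.
Qed.

Lemma shift_order : shift ^+ N = 1.
Proof.
apply/permP=> -[p c]; rewrite perm1; case: (shiftX N p c).
case: ((shift ^+ N) (p, c)) => p' c' /= -> e; congr (_, _); apply: val_inj.
by rewrite /= e modnDr modn_small.
Qed.

Hypothesis dvd3N : 3 %| N.

(** The exponent wraps round modulo [N]; as 3 divides [N], this keeps the residue modulo 3 on which
    the rotation depends. *)
Lemma shift_translation q :
  shift * q8_translation q * shift^-1 = q8_translation (q8_rot q).
Proof.
apply: (mulIg shift); rewrite mulgKV; apply/permP=> -[p c].
rewrite !permM shiftE !q8_translationE shiftE /=; congr (q8_mul p _, _).
by rewrite -iterSr iter_q8_rot_mod modn_dvdm // -iter_q8_rot_mod.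
Qed.

Definition model_group :=
  (<[q8_translation q8x]> <*> <[q8_translation q8y]> <*> <[shift]>)%G.

Lemma model_group_hom :
  model_group \homg Grp (x : y : z :
        x ^+ 2 = (x * y) ^+ 2, (x * y) ^+ 2 = y ^+ 2,
        z * x * z^-1 = y, z * y * z^-1 = x * y, z ^+ N).
Proof.
apply/existsP; exists (q8_translation q8x, q8_translation q8y, shift).
rewrite /= shift_order !shift_translation !q8_translationM !q8_translationX.
by rewrite !xpair_eqE !eqxx.
Qed.

Lemma leq_card_model_group : (8 * N <= #|model_group|)%N.
Proof.
have [c0 | N0] := posnP N; first by rewrite {1}c0 muln0.
pose t0 : q8 * 'I_N := (q8_1, Ordinal N0).
have -> : (8 * N)%N = #|[set: q8 * 'I_N]|.
  by rewrite cardsT !card_prod card_bool card_ord.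
suff /subset_leq_card/leq_trans :
    [set: q8 * 'I_N] \subset (fun s : {perm _} => s t0) @: model_group.
  by apply; apply: leq_imset_card.
apply/subsetP=> -[p c] _; apply/imsetP.
(* Right multiplication by [p], then by [z^c], takes the identity [t0] to [(p, c)]. *)
exists (q8_translation p * shift ^+ c); last first.
  rewrite permM q8_translationE; case: (shiftX c (q8_mul q8_1 p) (Ordinal N0)).
  case: ((shift ^+ c) _) => p' c' /= -> e; congr (_, _).
    by case: p => [[[] []] []].
  by apply: val_inj; rewrite /= e add0n modn_small.
have inH a :
    a \in [set q8_translation q8x; q8_translation q8y; shift] ->
  a \in model_group.
  rewrite !inE -!orbA => /or3P[] /eqP->; last 1 first.
  - by rewrite (subsetP (joing_subr _ _)) ?cycle_id.
  - by do 2!rewrite (subsetP (joing_subl _ _)) //; rewrite cycle_id.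
  - rewrite (subsetP (joing_subl _ _)) //.
    by rewrite (subsetP (joing_subr _ _)) ?cycle_id.
have -> : q8_translation p = let: (s, a, b) := p in
    q8_translation q8x ^+ (s.*2 + a) * q8_translation q8y ^+ b.
  case: p => [[s a] b]; rewrite !q8_translationX q8_translationM.
  by congr q8_translation; case: s a b => [] [] [].
by case: p => [[s a] b]; rewrite !groupM ?groupX ?inH // !inE eqxx ?orbT.
Qed.

End Model.

(** * Twisted conjugation on Q_8, by finite computation *)

(* P'8_3_class x y z i l is the set of all q z^(3 l + class_residue i) with q in
   class_q8 i. *)
Definition class_q8 (i : nat) : seq q8 :=
  let x2 := (true, false, false) in let x3 := (true, true, false) in
  let xy := (false, true, true) in
  let x2y := (true, false, true) in let x3y := (true, true, true) in
  nth [::] [:: [:: q8_1]; [:: x2]; [:: q8_1; x3; x2y; x3y];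
               [:: q8_1; q8x; q8y; xy]; [:: q8x; x2; q8y; xy];
               [:: x2; x3; x2y; x3y]; [:: q8x; q8y; x3; xy; x2y; x3y]] i.

Definition class_residue (i : nat) : nat := nth 0 [:: 0; 0; 1; 2; 1; 2; 0]%N i.

(* The Q_8-parts of the conjugates (p z^d) (q z^r) (p z^d)^-1; d < 3 suffices as
   z^3 is central. *)
Definition twisted_class (r : nat) (q : q8) : seq q8 :=
  [seq q8_mul p (q8_mul (iter d q8_rot q) (iter r q8_rot (q8_inv p)))
     | p <- q8_enum, d <- iota 0 3].

Lemma ltn_class_residue i : class_residue i < 3.
Proof.
(* Beyond the list, the default value 0 is still below 3. *)
by case: i => [|[|[|[|[|[|[|i]]]]]]] //; rewrite /class_residue nth_default.
Qed.

(** This check is what makes each list a single orbit, so that any of its members can represent the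
    class. *)
Lemma twisted_classE i q : i < 7 -> q \in class_q8 i ->
  twisted_class (class_residue i) q =i class_q8 i.
Proof.
have e :
    all (fun i =>
      all (fun q =>
        all (fun p => (p \in twisted_class (class_residue i) q)
                        == (p \in class_q8 i))
          q8_enum) (class_q8 i)) (iota 0 7) by vm_compute.
move=> lti qi p; apply/eqP; have := allP e i; rewrite mem_iota => /(_ lti).
by move=> /allP/(_ q qi)/allP/(_ p (mem_q8_enum p)).
Qed.

Lemma class_q8_cover r q : r < 3 ->
  exists2 i : 'I_7, class_residue i = r & q \in class_q8 i.
Proof.
have e :
    all (fun r =>
      all (fun q =>
        has (fun i => (class_residue i == r) && (q \in class_q8 i)) (iota 0 7))
        q8_enum) (iota 0 3) by vm_compute.
move=> ltr; have := allP e r.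
rewrite mem_iota => /(_ ltr) /allP/(_ q (mem_q8_enum q)).
case/hasP=> i; rewrite mem_iota => lti /andP[/eqP er qi].
by exists (Ordinal lti).
Qed.

(** With [class_q8_cover], the lists of a given residue partition Q_8; this half separates the
    families when classes are counted. *)
Lemma class_q8_disjoint i j q : i < 7 -> j < 7 ->
    class_residue i = class_residue j ->
  q \in class_q8 i -> q \in class_q8 j -> i = j.
Proof.
have e :
    all (fun i =>
      all (fun j => (class_residue i == class_residue j) ==>
                    has (mem (class_q8 i)) (class_q8 j) ==> (i == j))
        (iota 0 7)) (iota 0 7) by vm_compute.
move=> lti ltj r qi qj.
have := allP e i; rewrite mem_iota => /(_ lti)/allP/(_ j).
rewrite mem_iota r eqxx => /(_ ltj)/implyP/(_ isT)/implyP h.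
apply/eqP; apply: h.
by apply/hasP; exists q.
Qed.

Lemma class_q8_head i : i < 7 -> head q8_1 (class_q8 i) \in class_q8 i.
Proof. by case: i => [|[|[|[|[|[|[|i]]]]]]]. Qed.

Lemma class_q8_uniq i : i < 7 -> uniq (class_q8 i).
Proof. by case: i => [|[|[|[|[|[|[|i]]]]]]]. Qed.

Lemma size_class_q8 i : i < 7 -> size (class_q8 i) = P'8_3_class_size i.
Proof. by case: i => [|[|[|[|[|[|[|i]]]]]]]. Qed.

(** * Uniqueness of the normal form, conjugation and the classes *)

Section NormalForm.

Variables (N : nat) (gT : finGroupType) (G : {group gT}) (x y z : gT).
Hypothesis N_gt0 : 0 < N.
Hypothesis genG : <<[set x; y; z]>> = G.
Hypothesis x2 : x ^+ 2 = (x * y) ^+ 2.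
Hypothesis y2 : (x * y) ^+ 2 = y ^+ 2.
Hypothesis zx : z * x * z^-1 = y.
Hypothesis zy : z * y * z^-1 = x * y.
Hypothesis zN : z ^+ N = 1.
Hypothesis leG : (8 * N <= #|G|)%N.

Local Notation elt p c := (q8_val x y p * z ^+ c).

Lemma mem_elt p c : elt p c \in G.
Proof.
have inG a : a \in [set x; y; z] -> a \in G by rewrite -genG; apply: mem_gen.
by case: p => [[s a] b]; rewrite /= !groupM ?groupX ?inG // !inE eqxx ?orbT.
Qed.

Let eltp (t : q8 * 'I_N) := elt t.1 t.2.

Let eltp_mod p c : elt p c = eltp (p, Ordinal (ltn_pmod c N_gt0)).
Proof. by rewrite /eltp /= expg_mod. Qed.

(** The image contains the generators and is closed under products by [semidirect_mul], which in a
    finite group makes it a subgroup. *)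
Lemma normal_form : eltp @: setT = G.
Proof.
have gE : group_set (eltp @: setT).
  apply/group_setP; split.
    apply/imsetP; exists (q8_1, Ordinal N_gt0) => //.
    by rewrite /eltp q8_val1 mul1g.
  move=> _ _ /imsetP[[p c] _ ->] /imsetP[[q d] _ ->].
  by rewrite /eltp semidirect_mul // eltp_mod imset_f.
apply/eqP; rewrite eqEsubset; apply/andP; split.
  by apply/subsetP=> _ /imsetP[[p c] _ ->]; apply: mem_elt.
rewrite -genG (gen_subG _ (Group gE)) /=; apply/subsetP=> a.
rewrite !inE -orbA => /or3P[] /eqP->.
- by rewrite -(mulg1 x) -(q8_valx x y) -(expg0 z) eltp_mod imset_f.
- by rewrite -(mulg1 y) -(q8_valy x y) -(expg0 z) eltp_mod imset_f.
by rewrite -(mul1g z) -(q8_val1 x y) -[X in _ * X](expg1 z) eltp_mod imset_f.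
Qed.

(** A map from [8 * N] elements onto a group of at least that order is injective. *)
Lemma eltp_inj : injective eltp.
Proof.
have inj : {in [set: q8 * 'I_N] &, injective eltp}.
  apply/imset_injP.
  rewrite eqn_leq leq_imset_card normal_form (leq_trans _ leG) //.
  by rewrite cardsT !card_prod card_bool card_ord.
by move=> t u; apply: inj; rewrite inE.
Qed.

Lemma elt_inj p c q d : c < N -> d < N -> elt p c = elt q d -> p = q /\ c = d.
Proof.
move=> ltc ltd e; have := @eltp_inj (p, Ordinal ltc) (q, Ordinal ltd) e.
by case=> -> ->.
Qed.

Lemma elt_cover g : g \in G -> exists p c, c < N /\ g = elt p c.
Proof. by rewrite -normal_form => /imsetP[[p c] _ ->]; exists p, c. Qed.

(** Since [a ^ b] is [b^-1 * a * b], the inverse gives the convention [h g h^-1] used in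
    [twisted_class]. *)
Lemma conj_elt p d q c : elt q c ^ (elt p d)^-1 =
  elt (q8_mul p (q8_mul (iter d q8_rot q) (iter c q8_rot (q8_inv p)))) c.
Proof.
have conjVM (a b : gT) : a ^ b^-1 * b = b * a.
  by rewrite conjgE invgK mulgA mulgKV.
(* Multiplying by the conjugator avoids putting its inverse in normal form. *)
apply: (mulIg (elt p d)); rewrite conjVM !semidirect_mul // addnC.
congr (q8_val _ _ _ * _); rewrite -!q8_mulA -iter_q8_rotM.
have -> : q8_mul (q8_inv p) p = q8_1 by case: p => [[[] []] []].
have -> : iter c q8_rot q8_1 = q8_1 by elim: c => //= c ->.
by congr (q8_mul p _); case: (iter d _ q) => [[[] []] []].
Qed.

Lemma class_elt q c :
  elt q c ^: G = [set:: [seq elt p c | p <- twisted_class (c %% 3) q]].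
Proof.
apply/setP=> g; rewrite inE; apply/imsetP/mapP.
  case=> h /groupVr /elt_cover[p [d [_ eh]]] ->; rewrite -[h]invgK eh conj_elt.
  eexists; last by [].
  rewrite (iter_q8_rot_mod d) (iter_q8_rot_mod c).
  by apply/allpairsP; exists (p, d %% 3); rewrite mem_q8_enum mem_iota ltn_pmod.
case=> r /allpairsP[[p d] /= [_ _ ->]] ->; exists (elt p d)^-1.
  by rewrite groupV mem_elt.
by rewrite conj_elt (iter_q8_rot_mod c).
Qed.

Lemma P'8_3_class_set i l : i < 7 -> P'8_3_class x y z i l =
  [set:: [seq elt p (3 * l + class_residue i) | p <- class_q8 i]].
Proof.
by case: i => [|[|[|[|[|[|[|i]]]]]]] //= _;
  rewrite !set_cons set_nil setU0 ?setUA ?addn0 ?mulg1 ?mul1g.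
Qed.

Lemma P'8_3_class_elt i l q : i < 7 -> q \in class_q8 i ->
  P'8_3_class x y z i l = elt q (3 * l + class_residue i) ^: G.
Proof.
move=> lti qi; rewrite P'8_3_class_set // class_elt.
rewrite mulnC modnMDl modn_small ?ltn_class_residue //.
by apply/setP=> g; rewrite 2!in_set; apply/esym/eq_mem_map/twisted_classE.
Qed.

Variable M : nat.
Hypothesis NM : N = (3 * M)%N.

Lemma ltn_class_exp i l : l < M -> 3 * l + class_residue i < N.
Proof.
move=> ltl; rewrite NM (@leq_trans (3 * l.+1)) ?leq_mul2l //.
by rewrite mulnSr ltn_add2l ltn_class_residue.
Qed.

Lemma classes_eq :
  classes G = [set P'8_3_class x y z i l | i : 'I_7, l : 'I_M].
Proof.
apply/setP=> C; apply/imsetP/imset2P.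
  case=> g /elt_cover[q [c [ltc ->]]] ->.
  (* Divide [c] by 3: the remainder and [q] select the family [i], the quotient is [l]. *)
  have [i ri qi] := @class_q8_cover (c %% 3) q (ltn_pmod c (isT : 0 < 3)).
  have ltl : c %/ 3 < M by rewrite ltn_divLR // mulnC -NM.
  exists i (Ordinal ltl) => //=.
  by rewrite (P'8_3_class_elt _ (ltn_ord i) qi) ri mulnC -divn_eq.
case=> i l _ _ ->; have qi := class_q8_head (ltn_ord i).
rewrite (P'8_3_class_elt _ (ltn_ord i) qi); eexists; last by [].
exact: mem_elt.
Qed.

(** A representative of the first set lies in the second, so uniqueness of the normal form equates
    the Q_8-parts and the exponents; division by 3 then separates residue and parameter. *)
Lemma P'8_3_class_inj (i j : 'I_7) (l m : 'I_M) :
  P'8_3_class x y z i l = P'8_3_class x y z j m -> i = j /\ l = m.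
Proof.
move=> e; have qi := class_q8_head (ltn_ord i).
have: elt (head q8_1 (class_q8 i)) (3 * l + class_residue i)
    \in P'8_3_class x y z j m.
  by rewrite -e (P'8_3_class_elt _ (ltn_ord i) qi) class_refl.
rewrite P'8_3_class_set // inE => /mapP[p pj].
case/elt_inj; rewrite ?ltn_class_exp // => ep; rewrite ep in qi.
rewrite !(mulnC 3) => ec.
have er : class_residue i = class_residue j.
  have := congr1 (modn^~ 3) ec.
  by rewrite !modnMDl !modn_small ?ltn_class_residue.
split; apply: val_inj; first exact: class_q8_disjoint er qi pj.
have := congr1 (divn^~ 3) ec.
by rewrite !divnMDl // !divn_small ?ltn_class_residue // !addn0.
Qed.

Lemma card_classes : #|classes G| = (7 * M)%N.
Proof.
have -> : classes G = [set P'8_3_class x y z t.1 t.2 | t : 'I_7 * 'I_M].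
  rewrite classes_eq; apply/setP=> C; apply/imset2P/imsetP.
    by case=> i l _ _ ->; exists (i, l).
  by case=> -[i l] _ ->; exists i l.
rewrite card_imset ?card_prod ?card_ord // => -[i l] [j m] /=.
by case/P'8_3_class_inj=> -> ->.
Qed.

Lemma card_P'8_3_class (i : 'I_7) (l : 'I_M) :
  #|P'8_3_class x y z i l| = P'8_3_class_size i.
Proof.
rewrite P'8_3_class_set // cardsE -size_class_q8 //.
rewrite -(size_map (fun p => elt p (3 * l + class_residue i))).
apply/card_uniqP; rewrite map_inj_in_uniq ?class_q8_uniq // => p q _ _.
by case/elt_inj; rewrite ?ltn_class_exp.
Qed.

End NormalForm.

Theorem mainTheorem10 (k : nat) (hk : (2 <= k)%N) (gT : finGroupType)
    (G : {group gT}) (x y z : gT) (hG : is_P'8_3 k G x y z) :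
  [/\ classes G =
        [set P'8_3_class x y z i l | i : 'I_7, l : 'I_(3 ^ (k - 1))],
      #|classes G| = (7 * 3 ^ (k - 1))%N &
      forall (i : 'I_7) (l : 'I_(3 ^ (k - 1))),
        #|P'8_3_class x y z i l| = P'8_3_class_size i].
Proof.
case: hG => genG [x2 y2 zx zy zN] presG.
have NM : (3 ^ k = 3 * 3 ^ (k - 1))%N by rewrite -expnS subn1 prednK // ltnW.
have N_gt0 : 0 < (3 ^ k)%N by rewrite expn_gt0.
have dvd3N : 3 %| (3 ^ k)%N by rewrite NM dvdn_mulr.
have leG : (8 * 3 ^ k <= #|G|)%N.
  apply: leq_trans (leq_card_model_group _) _.
  (* By [presG] the model is an image of [G] itself, and a morphism cannot raise the order. *)
  have := model_group_hom dvd3N; rewrite -presG => /homgP[f <-].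
  exact: leq_morphim.
split; first exact: classes_eq NM.
  exact: (card_classes N_gt0 genG x2 y2 zx zy zN leG NM).
exact: (card_P'8_3_class N_gt0 genG x2 y2 zx zy zN leG NM).
Qed.
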